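(* For every $\mathbf{K}\in\mathcal{K}\setminus\{\mathbf{K}^\star\}$, $$\langle \nabla\mathcal{J}(\mathbf{K}),\,\mathbf{K}-\mathbf{K}^\star \rangle = \mathcal{J}(\mathbf{K})-\mathcal{J}^\star + \big(1-\tau(\mathbf{K})\big)\,Q_H(\mathbf{K}).$$ In particular, the star-convexity inequality $\langle\nabla\mathcal{J}(\mathbf{K}),\mathbf{K}-\mathbf{K}^\star\rangle\ge\mathcal{J}(\mathbf{K})-\mathcal{J}^\star$ holds at $\mathbf{K}$ if and only if $\tau(\mathbf{K})\le 1$.
   Context: Setting. $\{\rho_1,\dots,\rho_S\}$ is a finite grid with weights $\nu_s>0$, $\sum_{s=1}^S\nu_s=1$. $w_1,\dots,w_N$ are continuous weighting functions with $w_i(\rho)\ge 0$ and $\sum_{i=1}^N w_i(\rho)=1$; $A(\rho)=\sum_i w_i(\rho)A_i$ and $B(\rho)=\sum_i w_i(\rho)B_i$ with $A_i\in\mathbb{R}^{n\times n}$, $B_i\in\mathbb{R}^{n\times m}$. The matrices $Q,\Sigma_0\in\mathbb{R}^{n\times n}$ and $R\in\mathbb{R}^{m\times m}$ are symmetric positive definite. A gain $K\in\mathbb{R}^{m\times n}$ stabilizes plant $s$ if $A_{\mathrm{cl}}=A(\rho_s)-B(\rho_s)K$ is Schur stable (spectral radius $<1$). For such $K$: $P$ is the solution of $P=A_{\mathrm{cl}}^\top P A_{\mathrm{cl}}+Q+K^\top RK$; $\Sigma$ is the solution of $\Sigma=A_{\mathrm{cl}}\Sigma A_{\mathrm{cl}}^\top+\Sigma_0$;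 $J_s(K)=\operatorname{tr}(P\Sigma_0)$; $H=R+B(\rho_s)^\top PB(\rho_s)$; $E=HK-B(\rho_s)^\top PA(\rho_s)$. A schedule is a tuple $\mathbf{K}=(K_1,\dots,K_N)$ of matrices in $\mathbb{R}^{m\times n}$; its deployed gain at grid point $s$ is $K_{\mathbf{K}}(\rho_s)=\sum_i w_i(\rho_s)K_i$. The feasible set is the open set $\mathcal{K}=\{\mathbf{K}: K_{\mathbf{K}}(\rho_s)\text{ stabilizes plant } s,\ s=1,\dots,S\}$, and the scheduled cost is $\mathcal{J}(\mathbf{K})=\sum_s\nu_s J_s(K_{\mathbf{K}}(\rho_s))$ on $\mathcal{K}$. Write $P_s,\Sigma_s,E_s,H_s$ for the matrices $P,\Sigma,E,H$ of plant $s$ at the deployed gain $K=K_{\mathbf{K}}(\rho_s)$. The gradient $\nabla\mathcal{J}(\mathbf{K})$ has blocks $\nabla_{K_i}\mathcal{J}(\mathbf{K})=2\sum_s\nu_s w_i(\rho_s)E_s\Sigma_s$. Standing assumptions: $\mathcal{K}\ne\emptyset$ and $G_w=\sum_s\nu_s w(\rho_s)w(\rho_s)^\top\succ0$, where $w(\rho)=(w_1(\rho),\dots,w_N(\rho))^\top$. Under these, $\mathcal{J}$ attains its minimum over $\mathcal{K}$; $\mathbf{K}^\star\in\mathcal{K}$ denotes a fixed minimizer, $\mathcal{J}^\star=\mathcal{J}(\mathbf{K}^\star)$, and $\Sigma_s^\star$ is the covariance $\Sigma$ of plant $s$ at the gain $K_{\mathbf{K}^\star}(\rho_s)$. The inner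 product is $\langle X,Y\rangle=\operatorname{tr}(X^\top Y)$, summed over the tuple. The starred gradient $\nabla^{\star}\mathcal{J}(\mathbf{K})$ is the tuple with blocks $\nabla^{\star}_{K_i}\mathcal{J}(\mathbf{K})=2\sum_s\nu_s w_i(\rho_s)E_s\Sigma_s^\star$ (with $E_s$ evaluated at $\mathbf{K}$). With $\Delta_s=K_{\mathbf{K}}(\rho_s)-K_{\mathbf{K}^\star}(\rho_s)$, $Q_H(\mathbf{K})=\sum_s\nu_s\operatorname{tr}(\Sigma_s^\star\Delta_s^\top H_s\Delta_s)$, which is positive for $\mathbf{K}\neq\mathbf{K}^\star$. The remainder field is $\boldsymbol{\mathcal{R}}(\mathbf{K})=\tfrac12(\nabla^{\star}\mathcal{J}(\mathbf{K})-\nabla\mathcal{J}(\mathbf{K}))$, and for $\mathbf{K}\ne\mathbf{K}^\star$ the mismatch ratio is $\tau(\mathbf{K})=2\langle\boldsymbol{\mathcal{R}}(\mathbf{K}),\mathbf{K}-\mathbf{K}^\star\rangle/Q_H(\mathbf{K})$. *)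

(* Defs.v *)
From HB Require Import structures.
From mathcomp Require Import all_boot all_order all_algebra.
From mathcomp Require Import complex.
From mathcomp Require Import all_classical all_reals all_analysis.

Set Implicit Arguments.
Unset Strict Implicit.
Unset Printing Implicit Defensive.

Import Order.TTheory GRing.Theory Num.Theory.
Import numFieldNormedType.Exports.

Local Open Scope classical_set_scope.
Local Open Scope ring_scope.

Definition posdef (R : realType) (n : nat) (M : 'M[R]_n) : Prop :=
  M^T = M /\ forall v : 'cV[R]_n, v != 0 -> 0 < (v^T *m M *m v) 0 0.

(* The supremum ranges over the complex eigenvalues, a finite set that is empty
   only when n = 0; in that case sup is 0. *)
Definition spectral_radius (R : realType) (n : nat) (M : 'M[R]_n) : R :=
  sup [set r : R | exists z : R[i],
         eigenvalue (map_mx (real_complex R) M) z /\ `|z| = real_complex R r].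

Definition schur_stable (R : realType) (n : nat) (M : 'M[R]_n) : Prop :=
  spectral_radius M < 1.

(* S grid points, N schedule vertices, state dimension n, input dimension m;
   T is the space in which the scheduling parameter lives. *)
Record lpv (R : realType) (T : Type) (S N n m : nat) := LPV {
  grid : 'I_S -> T;
  wgt : 'I_S -> R;
  w : 'I_N -> T -> R;
  Avert : 'I_N -> 'M[R]_n;
  Bvert : 'I_N -> 'M[R]_(n, m);
  Qcost : 'M[R]_n;
  Rcost : 'M[R]_m;
  Sigma0 : 'M[R]_n }.

Notation schedule R N m n := {ffun 'I_N -> 'M[R]_(m, n)}.

Section Lpv.
Context (R : realType) (T : Type) (S N n m : nat) (L : lpv R T S N n m).

Definition Amat (p : T) : 'M[R]_n := \sum_(i < N) w L i p *: Avert L i.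
Definition Bmat (p : T) : 'M[R]_(n, m) := \sum_(i < N) w L i p *: Bvert L i.

Definition Acl (s : 'I_S) (K : 'M[R]_(m, n)) : 'M[R]_n :=
  Amat (grid L s) - Bmat (grid L s) *m K.

Definition stabilizes (s : 'I_S) (K : 'M[R]_(m, n)) : Prop :=
  schur_stable (Acl s K).

(* [xget 0] selects a solution of the equation; for a stabilizing gain the
   solution exists and is unique. The value is irrelevant otherwise. *)
Definition Pmat (s : 'I_S) (K : 'M[R]_(m, n)) : 'M[R]_n :=
  xget 0 [set P | P = (Acl s K)^T *m P *m Acl s K
                      + Qcost L + K^T *m Rcost L *m K].

Definition Sigma (s : 'I_S) (K : 'M[R]_(m, n)) : 'M[R]_n :=
  xget 0 [set X | X = Acl s K *m X *m (Acl s K)^T + Sigma0 L].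

Definition plant_cost (s : 'I_S) (K : 'M[R]_(m, n)) : R :=
  \tr (Pmat s K *m Sigma0 L).

Definition Hmat (s : 'I_S) (K : 'M[R]_(m, n)) : 'M[R]_m :=
  Rcost L + (Bmat (grid L s))^T *m Pmat s K *m Bmat (grid L s).

Definition Emat (s : 'I_S) (K : 'M[R]_(m, n)) : 'M[R]_(m, n) :=
  Hmat s K *m K - (Bmat (grid L s))^T *m Pmat s K *m Amat (grid L s).

Definition deployed (K : schedule R N m n) (s : 'I_S) : 'M[R]_(m, n) :=
  \sum_(i < N) w L i (grid L s) *: K i.

Definition feasible : set (schedule R N m n) :=
  [set K | forall s : 'I_S, stabilizes s (deployed K s)].

Definition cost (K : schedule R N m n) : R :=
  \sum_(s < S) wgt L s * plant_cost s (deployed K s).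

Definition is_minimizer (K : schedule R N m n) : Prop :=
  feasible K /\ forall K' : schedule R N m n, feasible K' -> cost K <= cost K'.

Definition inner (X Y : schedule R N m n) : R :=
  \sum_(i < N) \tr ((X i)^T *m Y i).

Definition unit_schedule (i : 'I_N) (a : 'I_m) (b : 'I_n) : schedule R N m n :=
  [ffun j => if j == i then delta_mx a b else 0].

(* The gradient for [inner]: the tuple of all entrywise partial derivatives.
   On [feasible], which is open, block i equals
   2 \sum_s wgt_s w_i(rho_s) E_s Sigma_s. *)
Definition grad (K : schedule R N m n) : schedule R N m n :=
  [ffun i => \matrix_(a, b)
     derive1 (fun t : R => cost (K + t *: unit_schedule i a b)) 0].

Definition Gram : 'M[R]_N :=
  \sum_(s < S) wgt L s *:
    ((\col_i w L i (grid L s)) *m (\col_i w L i (grid L s))^T).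

Section Star.
Variable Kstar : schedule R N m n.

Definition Sigma_star (s : 'I_S) : 'M[R]_n := Sigma s (deployed Kstar s).

Definition grad_star (K : schedule R N m n) : schedule R N m n :=
  [ffun i => 2 *: \sum_(s < S) (wgt L s * w L i (grid L s)) *:
                (Emat s (deployed K s) *m Sigma_star s)].

Definition Delta (K : schedule R N m n) (s : 'I_S) : 'M[R]_(m, n) :=
  deployed K s - deployed Kstar s.

Definition QH (K : schedule R N m n) : R :=
  \sum_(s < S) wgt L s *
    \tr (Sigma_star s *m (Delta K s)^T *m Hmat s (deployed K s) *m Delta K s).

Definition remainder (K : schedule R N m n) : schedule R N m n :=
  2^-1 *: (grad_star K - grad K).

Definition mismatch (K : schedule R N m n) : R :=
  2 * inner (remainder K) (K - Kstar) / QH K.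

End Star.
End Lpv.

(* Main.v *)
Require Import Defs.
From HB Require Import structures.
From mathcomp Require Import all_boot all_order all_algebra.
From mathcomp Require Import complex.
From mathcomp Require Import all_classical all_reals all_analysis.
From mathcomp Require Import ring lra.

(** The gradient of the cost cancels between the left-hand side and the mismatch
    ratio, so the identity amounts to
    <grad_star J(K), K - K*> = J(K) - J* + Q_H(K) together with Q_H(K) > 0.
    The first fact is the exact LQR cost-difference formula, applied plant by
    plant: for P the value matrix at K and X the covariance at K',
    tr(P S0) = tr(X (P - F'^T P F')) with F' the closed loop at K', and completing
    the expansion of F' = F + B (K - K') leaves only E and H terms. Both facts
    require that P and X exist and are positive definite; these solve the Stein
    equation X = F^T X F + Q, which is well posed because the powers of a
    Schur-stable matrix vanish. *)

Set Implicit Arguments.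
Unset Strict Implicit.
Unset Printing Implicit Defensive.

Import Order.TTheory GRing.Theory Num.Theory.
Import numFieldNormedType.Exports.

Local Open Scope classical_set_scope.
Local Open Scope ring_scope.

(** * Decay of the powers of a Schur-stable matrix *)

(** The constant [c' = |u 0| + c / (r - |z|)] satisfies [c + |z| * c' <= r * c'], so the bound
    passes from [k] to [k.+1]. *)
Lemma geometric_recurrence_bound (F : numFieldType) (z r c : F) (u : nat -> F) :
  `|z| < r -> (forall k, `|u k.+1 - z * u k| <= c * r ^+ k) ->
  exists c', forall k, `|u k| <= c' * r ^+ k.
Proof.
move=> zr uP.
have c_ge0 : 0 <= c by have := uP 0%N; rewrite expr0 mulr1; apply: le_trans.
have rz_gt0 : 0 < r - `|z| by rewrite subr_gt0.
pose c' := `|u 0%N| + c / (r - `|z|).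
have cc' : c <= (r - `|z|) * c'.
  by rewrite mulrDr mulrCA divff ?gt_eqF// mulr1 lerDr mulr_ge0// ltW.
exists c'; elim=> [|k IHk].
  by rewrite expr0 mulr1 lerDl divr_ge0// ltW.
have r_ge0 : 0 <= r by rewrite (le_trans _ (ltW zr)).
rewrite -[u k.+1](subrK (z * u k)) (le_trans (ler_normD _ _))//.
have zu : `|z * u k| <= `|z| * (c' * r ^+ k) by rewrite normrM ler_wpM2l.
rewrite (le_trans (lerD (uP k) zu))// exprS mulrA -mulrDl mulrA.
rewrite ler_wpM2r ?exprn_ge0// (le_trans (lerD cc' (lexx _)))//.
by rewrite -mulrDl subrK mulrC.
Qed.

(* If p(A) M = 0 with p split, each linear factor of p peels off one first-order
   scalar recurrence on the entries of A^k M. *)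
Lemma annihilated_powers_bound (F : numFieldType) (n p : nat)
    (A : 'M[F]_n.+1) (r : F) (rs : seq F) (M : 'M[F]_(n.+1, p)) :
  (forall z, z \in rs -> `|z| < r) ->
  horner_mx A (\prod_(z <- rs) ('X - z%:P)) *m M = 0 ->
  forall i j, exists c, forall k, `|(A ^+ k *m M) i j| <= c * r ^+ k.
Proof.
elim: rs M => [|z rs IHrs] M rsP.
  rewrite big_nil rmorph1 mul1mx => -> i j.
  by exists 0 => k; rewrite mulmx0 mxE normr0 mul0r.
rewrite big_cons mulrC rmorphM/= -mulmxA => AM0 i j.
have [y yrs|c cP] := IHrs _ _ AM0 i j; first by rewrite rsP// inE yrs orbT.
apply: (@geometric_recurrence_bound _ z r c); first by rewrite rsP// mem_head.
move=> k; have := cP k; congr (`|_| <= _).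
rewrite rmorphB/= horner_mx_X horner_mx_C mulmxBl mulmxBr mul_scalar_mx.
by rewrite -scalemxAr mulmxA -[A ^+ k *m A]exprSr !mxE.
Qed.

Definition vanishes (R : realType) (p q : nat) (Y : nat -> 'M[R]_(p, q)) : Prop :=
  forall i j, Y k i j @[k --> \oo] --> (0 : R).

Definition modulus (R : realType) (z : R[i]) : R :=
  Num.sqrt (complex.Re z ^+ 2 + complex.Im z ^+ 2).

Lemma normC_modulus (R : realType) (z : R[i]) :
  `|z| = real_complex R (modulus z).
Proof. by case: z. Qed.

(** Over [R[i]] the characteristic polynomial splits, and by Cayley-Hamilton it annihilates [A]; the
    powers then decay at any rate strictly above the spectral radius. *)
Lemma schur_stable_vanishes (R : realType) (n : nat) (A : 'M[R]_n) :
  schur_stable A -> vanishes (fun k => A ^+ k).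
Proof.
case: n A => [A _ []//|n A]; rewrite /schur_stable /spectral_radius.
set E := [set r | _] => rho_lt1.
pose AC := map_mx (real_complex R) A.
have [rs] := closed_field_poly_normal (char_poly AC).
rewrite (monicP (char_poly_monic _)) scale1r => rsE.
have rsP z : (z \in rs) = eigenvalue AC z.
  by rewrite eigenvalue_root_char rsE root_prod_XsubC.
(* [sup] dominates the members of [E] only once [E] is bounded. *)
have Eub : has_ubound E.
  exists (\sum_(z <- rs) modulus z) => x [z []].
  rewrite -rsP normC_modulus => zrs [<-].
  rewrite (big_rem z)//= lerDl sumr_ge0// => y _.
  exact: sqrtr_ge0.
(* A midpoint, to lie strictly between [sup E] and 1; the maximum with 0 keeps it nonnegative. *)
pose r := (Num.max 0 (sup E) + 1) / 2.
have [r_ge0 r_lt1 r_sup] : [/\ 0 <= r, r < 1 & sup E < r].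
  by rewrite /r; have [s_ge0|s_lt0] := leP 0 (sup E); split; lra.
have rs_lt z : z \in rs -> `|z| < real_complex R r.
  rewrite rsP => zA; rewrite normC_modulus ltcR (le_lt_trans _ r_sup)//.
  by apply: (ub_le_sup Eub); exists z; rewrite normC_modulus.
have AC0 : horner_mx AC (\prod_(z <- rs) ('X - z%:P)) *m 1%:M = 0.
  by rewrite -rsE Cayley_Hamilton mul0mx.
move=> i j; have [c cP] := annihilated_powers_bound rs_lt AC0 i j.
(* The constant [c] is complex, but an inequality in [R[i]] compares real parts. *)
have AkP k : `|(A ^+ k) i j| <= complex.Re c * r ^+ k.
  have := cP k; rewrite mulmx1 -rmorphXn mxE -(rmorphXn (real_complex R)).
  rewrite normC_modulus /modulus /= expr0n addr0 sqrtr_sqr.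
  by case: {cP} c => a b; rewrite lecE => /andP[_] /=; rewrite mulr0 subr0.
apply/norm_cvg0P.
apply: (squeeze_cvgr (f := fun=> 0) (h := geometric (complex.Re c) r)).
- by apply: nearW => k; rewrite normr_ge0 AkP.
- exact: cvg_cst.
- by apply: cvg_geometric; rewrite ger0_norm.
Qed.

Lemma vanishes_mulmx (R : realType) (p q l : nat)
    (Y : nat -> 'M[R]_(p, q)) (Z : nat -> 'M[R]_(q, l)) :
  vanishes Y -> vanishes Z -> vanishes (fun k => Y k *m Z k).
Proof.
move=> Y0 Z0 i j; under eq_fun do rewrite mxE.
elim: (index_enum _) => [|a s IHs].
  by under eq_fun do rewrite big_nil; exact: cvg_cst.
under eq_fun do rewrite big_cons.
by have := cvgD (cvgM (Y0 i a) (Z0 a j)) IHs; rewrite mulr0 addr0; apply.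
Qed.

Lemma vanishes_mulmxr (R : realType) (p q l : nat)
    (Y : nat -> 'M[R]_(p, q)) (B : 'M[R]_(q, l)) :
  vanishes Y -> vanishes (fun k => Y k *m B).
Proof.
move=> Y0 i j; under eq_fun do rewrite mxE.
elim: (index_enum _) => [|a s IHs].
  by under eq_fun do rewrite big_nil; exact: cvg_cst.
under eq_fun do rewrite big_cons.
have := cvgD (cvgM (Y0 i a) (cvg_cst (B a j))) IHs.
by rewrite mul0r addr0; apply.
Qed.

Lemma vanishes_trmx (R : realType) (p q : nat) (Y : nat -> 'M[R]_(p, q)) :
  vanishes Y -> vanishes (fun k => (Y k)^T).
Proof. by move=> Y0 i j; under eq_fun do rewrite mxE; exact: Y0. Qed.

Lemma trmx_exp (R : comPzRingType) (n : nat) (A : 'M[R]_n) k :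
  (A ^+ k)^T = A^T ^+ k.
Proof.
elim: k => [|k IHk]; first by rewrite !expr0 trmx1.
by rewrite exprS [in RHS]exprSr -IHk trmx_mul.
Qed.

Lemma vanishes_exp_trmx (R : realType) (n : nat) (A : 'M[R]_n) :
  vanishes (fun k => A ^+ k) -> vanishes (fun k => A^T ^+ k).
Proof. by move=> /vanishes_trmx; under eq_fun do rewrite trmx_exp. Qed.

(** * The Stein equation for a matrix with vanishing powers *)

Section Stein.
Context (R : realType) (n : nat) (A : 'M[R]_n).
Context (A_vanishes : vanishes (fun k => A ^+ k)).

Lemma vanishes_congr (p : nat) (X : 'M[R]_n) (B : 'M[R]_(n, p)) :
  vanishes (fun k => (A ^+ k *m B)^T *m X *m (A ^+ k *m B)).
Proof.
have AB0 := vanishes_mulmxr B A_vanishes.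
exact: (vanishes_mulmx (vanishes_mulmxr X (vanishes_trmx AB0)) AB0).
Qed.

(** Iterating the equation gives [X = (A ^+ k)^T *m X *m A ^+ k] for all [k], and the right-hand
    side tends to 0. *)
Lemma stein_eq0 (X : 'M[R]_n) : X = A^T *m X *m A -> X = 0.
Proof.
move=> XE; have XkE k : X = (A ^+ k *m 1%:M)^T *m X *m (A ^+ k *m 1%:M).
  rewrite mulmx1; elim: k => [|k IHk]; first by rewrite expr0 trmx1 mul1mx mulmx1.
  by rewrite exprS trmx_mul -!mulmxA [X *m _]mulmxA [A^T *m _]mulmxA mulmxA
    [A^T *m _]mulmxA -XE.
apply/matrixP => i j; rewrite mxE.
have := vanishes_congr X 1%:M i j; under eq_fun do rewrite -XkE.
by move=> /(cvg_lim (@Rhausdorff R)) <-; rewrite lim_cst.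
Qed.

Lemma stein_inj (Q X Y : 'M[R]_n) :
  X = A^T *m X *m A + Q -> Y = A^T *m Y *m A + Q -> X = Y.
Proof.
move=> XE YE; apply/eqP; rewrite -subr_eq0; apply/eqP/stein_eq0.
by rewrite {1}XE {1}YE mulmxBr mulmxBl opprD addrACA subrr addr0.
Qed.

Lemma stein_sym (Q X : 'M[R]_n) :
  Q^T = Q -> X = A^T *m X *m A + Q -> X^T = X.
Proof.
move=> QT XE; apply: (@stein_inj Q) => //.
by rewrite {1}XE linearD/= !trmx_mul trmxK QT mulmxA.
Qed.

(** The linear map sending [X] to [X - A^T *m X *m A] is injective by [stein_eq0], hence invertible
    in finite dimension; [M] is its matrix on vectorized arguments. *)
Lemma stein_exists (Q : 'M[R]_n) : exists X, X = A^T *m X *m A + Q.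
Proof.
pose M : 'M[R]_(n * n) := 1%:M - lin_mx (mulmx A^T) *m lin_mx (mulmxr A).
have ME X : mxvec X *m M = mxvec (X - A^T *m X *m A).
  by rewrite mulmxBr mulmx1 mulmxA !mul_vec_lin linearB.
have Mu : M \in unitmx.
  rewrite -row_free_unit -kermx_eq0; apply/eqP/row_matrixP => i.
  rewrite row0 -[row i _]vec_mxK.
  have /sub_kermxP := row_sub i (kermx M).
  rewrite -[row i _]vec_mxK ME => /(congr1 vec_mx).
  by rewrite mxvecK linear0 => /subr0_eq /stein_eq0 ->; rewrite !linear0.
exists (vec_mx (mxvec Q *m invmx M)).
set X := vec_mx _; have : mxvec X *m M = mxvec Q by rewrite vec_mxK mulmxKV.
by rewrite ME => /(can_inj mxvecK) <-; rewrite addrC subrK.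
Qed.

(** Along the orbit [A ^+ k *m v] the form of [X] never increases, each drop being a value of the
    form of [Q], and it tends to 0; so it starts nonnegative. *)
Lemma stein_ge0 (Q X : 'M[R]_n) :
  (forall v : 'cV[R]_n, 0 <= (v^T *m Q *m v) 0 0) ->
  X = A^T *m X *m A + Q -> forall v : 'cV[R]_n, 0 <= (v^T *m X *m v) 0 0.
Proof.
move=> Q_ge0 XE v.
have step (u : 'cV_n) :
    ((A *m u)^T *m X *m (A *m u)) 0 0 <= (u^T *m X *m u) 0 0.
  rewrite [in leRHS]XE mulmxDr mulmxDl [leRHS]mxE trmx_mul !mulmxA lerDl.
  exact: Q_ge0.
have desc k :
    ((A ^+ k *m v)^T *m X *m (A ^+ k *m v)) 0 0 <= (v^T *m X *m v) 0 0.
  elim: k => [|k IHk]; first by rewrite expr0 mul1mx.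
  by rewrite exprS -[A * _ *m v]mulmxA (le_trans (step _)).
apply: (cvgr_to_le (vanishes_congr X v 0 0)).
by apply: nearW => k; exact: desc.
Qed.

Lemma stein_posdef (Q X : 'M[R]_n) :
  posdef Q -> X = A^T *m X *m A + Q -> posdef X.
Proof.
move=> [QT Q_gt0] XE; split; first exact: stein_sym XE.
have Q_ge0 (u : 'cV_n) : 0 <= (u^T *m Q *m u) 0 0.
  by have [->|/Q_gt0 /ltW//] := eqVneq u 0; rewrite mulmx0 mxE.
move=> v v_neq0; rewrite XE mulmxDr mulmxDl mxE ltr_wpDl ?Q_gt0//.
by have := stein_ge0 Q_ge0 XE (A *m v); rewrite trmx_mul !mulmxA.
Qed.

End Stein.

(** * Positive definite matrices *)

Lemma posdef_unitmx (R : realType) (n : nat) (M : 'M[R]_n) :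
  posdef M -> M \in unitmx.
Proof.
move=> [_ M_gt0]; rewrite unitmxE unitfE; apply/det0P => -[v v_neq0 vM].
have := M_gt0 v^T; rewrite trmx_eq0 => /(_ v_neq0).
by rewrite trmxK vM mul0mx mxE ltxx.
Qed.

Lemma posdef_ge0 (R : realType) (n : nat) (M : 'M[R]_n) (v : 'cV[R]_n) :
  posdef M -> 0 <= (v^T *m M *m v) 0 0.
Proof.
move=> [_ M_gt0]; have [->|/M_gt0/ltW//] := eqVneq v 0.
by rewrite mulmx0 mxE.
Qed.

Lemma posdef_addr_congr (R : realType) (n m : nat) (M : 'M[R]_n) (P : 'M[R]_m)
    (B : 'M[R]_(m, n)) :
  posdef M -> posdef P -> posdef (M + B^T *m P *m B).
Proof.
move=> [MT M_gt0] Ppd; split.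
  by rewrite linearD/= !trmx_mul trmxK MT Ppd.1 mulmxA.
move=> v v_neq0; rewrite mulmxDr mulmxDl mxE ltr_wpDr ?M_gt0//.
by have := posdef_ge0 (B *m v) Ppd; rewrite trmx_mul !mulmxA.
Qed.

Lemma posdef_cholesky (R : realType) (n : nat) (M : 'M[R]_n) :
  posdef M -> exists C : 'M[R]_n, M = C *m C^T.
Proof.
elim: n M => [|n IHn] M; first by exists 0; rewrite [LHS]flatmx0 [RHS]flatmx0.
rewrite -add1n in M *; move=> [MT M_gt0].
pose a := M 0 0; pose b := dlsubmx M; pose D := drsubmx M.
have ME : M = block_mx a%:M b^T b D.
  rewrite -[LHS]submxK; congr block_mx; last by rewrite /b trmx_dlsub MT.
  apply/matrixP => i j; rewrite !ord1 !mxE eqxx mulr1n.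
  by congr (M _ _); apply/val_inj.
have a_gt0 : 0 < a.
  have := M_gt0 (col_mx 1%:M 0); rewrite col_mx_eq0 oner_eq0 => /(_ isT).
  rewrite ME tr_col_mx mul_row_block mul_row_col !mulmx0 addr0.
  by rewrite !trmx0 !mul0mx addr0 trmx1 mul1mx mulmx1 mxE eqxx.
have DT : D^T = D by rewrite /D trmx_drsub MT.
(* The Schur complement of the top-left entry is again positive definite. *)
have [|C CE] := IHn (D - a^-1 *: (b *m b^T)).
  split; first by rewrite linearB linearZ/= trmx_mul trmxK DT.
  (* This [x] minimizes the form of [M] at [col_mx x u] over the first coordinate; the minimum is
     the Schur complement form at [u]. *)
  move=> u u_neq0; pose x : 'cV_1 := - a^-1 *: (b^T *m u).
  have := M_gt0 (col_mx x u); rewrite col_mx_eq0 (negPf u_neq0) andbF => /(_ isT).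
  rewrite ME tr_col_mx mul_row_block mul_row_col.
  have -> : x^T *m a%:M + u^T *m b = 0.
    rewrite mul_mx_scalar linearZ/= trmx_mul trmxK scalerA mulrN divff ?gt_eqF//.
    by rewrite scaleN1r addNr.
  rewrite mul0mx add0r mulmxBr [x^T]linearZ/= trmx_mul trmxK addrC.
  by rewrite -scalemxAl scaleNr -mulmxA scalemxAr.
pose s := Num.sqrt a.
have ss : s * s = a by rewrite -expr2 sqr_sqrtr ?ltW.
have s_neq0 : s != 0 by rewrite gt_eqF// sqrtr_gt0.
exists (block_mx s%:M 0 (s^-1 *: b) C).
rewrite ME tr_block_mx mulmx_block !trmx0 !mul0mx !mulmx0 !addr0.
rewrite ![(_ *: _)^T]linearZ/= tr_scalar_mx -scalar_mxM ss -scalemxAr.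
rewrite mul_scalar_mx scalerA mulVf// scale1r -!scalemxAl mul_mx_scalar scalerA mulVf// scale1r.
by rewrite -scalemxAr scalerA -invfM ss -CE addrC subrK.
Qed.

(** With [X = C *m C^T] and [W = D *m C], the trace is the sum of the [H]-forms of the columns of
    [W], and [W] is nonzero because [X] is invertible. *)
Lemma mxtrace_congr_gt0 (R : realType) (n m : nat) (X : 'M[R]_n) (H : 'M[R]_m)
    (D : 'M[R]_(m, n)) :
  posdef X -> posdef H -> D != 0 -> 0 < \tr (X *m D^T *m H *m D).
Proof.
move=> Xpd Hpd D_neq0; have [C CE] := posdef_cholesky Xpd.
pose W := D *m C.
have trE : \tr (X *m D^T *m H *m D)
    = \sum_j ((col j W)^T *m H *m col j W) 0 0.
  rewrite CE -!mulmxA mxtrace_mulC !mulmxA -trmx_mul -[_ *m D *m C]mulmxA -/W.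
  apply: eq_bigr => j _; rewrite tr_col -row_mul !mxE.
  by apply: eq_bigr => i _; rewrite !mxE.
have [j Wj] : exists j, col j W != 0.
  apply/existsP; apply: contraNT D_neq0; rewrite negb_exists => /forallP W0.
  rewrite -(mulmxK (posdef_unitmx Xpd) D) CE mulmxA -/W.
  suff -> : W = 0 by rewrite !mul0mx.
  apply/matrixP => i j; have := W0 j; rewrite negbK => /eqP/matrixP/(_ i 0).
  by rewrite !mxE.
rewrite trE (bigD1 j)//= ltr_pwDl ?Hpd.2// sumr_ge0// => i _.
exact: posdef_ge0.
Qed.

(** * The LQR cost-difference formula *)

(** The Stein operators of [F] and [F^T] are adjoint for the trace pairing. *)
Lemma mxtrace_stein (R : comPzRingType) (n : nat) (F X P S0 : 'M[R]_n) :
  X = F *m X *m F^T + S0 -> \tr (P *m S0) = \tr (X *m (P - F^T *m P *m F)).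
Proof.
move=> XE; have -> : S0 = X - F *m X *m F^T by rewrite {1}XE addrC addKr.
rewrite !mulmxBr !raddfB/= [\tr (P *m X)]mxtrace_mulC; congr (_ - _).
by rewrite !mulmxA [LHS]mxtrace_mulC !mulmxA [LHS]mxtrace_mulC !mulmxA.
Qed.


Lemma cost_difference (R : comPzRingType) (n m : nat) (A Q S0 P P' X : 'M[R]_n)
    (B : 'M[R]_(n, m)) (Rc : 'M[R]_m) (K K' : 'M[R]_(m, n)) :
  P^T = P -> Rc^T = Rc -> X^T = X ->
  P = (A - B *m K)^T *m P *m (A - B *m K) + Q + K^T *m Rc *m K ->
  P' = (A - B *m K')^T *m P' *m (A - B *m K') + Q + K'^T *m Rc *m K' ->
  X = (A - B *m K') *m X *m (A - B *m K')^T + S0 ->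
  let H := Rc + B^T *m P *m B in
  let E := H *m K - B^T *m P *m A in
  let D := K - K' in
  \tr (P *m S0) - \tr (P' *m S0)
    = 2 * \tr (X *m D^T *m E) - \tr (X *m D^T *m H *m D).
Proof.
move=> PT RT XT PE P'E XE H E D.
rewrite !(mxtrace_stein _ XE) -raddfB -mulmxBr/=.
have -> : P' - (A - B *m K')^T *m P' *m (A - B *m K') = Q + K'^T *m Rc *m K'.
  by rewrite {1}P'E -[X in X - _]addrA [LHS]addrC addKr.
have F'E : A - B *m K' = (A - B *m K) + B *m D.
  by rewrite mulmxBr addrA subrK.
have K'E : K' = K - D by rewrite opprB addrC subrK.
rewrite F'E [X in _ *m Rc *m X]K'E [X in X^T *m Rc]K'E.
set F := A - B *m K in PE *.
have EE : E = Rc *m K - B^T *m P *m F.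
  by rewrite /E /H mulmxDl /F mulmxBr !mulmxA opprB addrA.
clearbody E F D.
have ET : E^T = K^T *m Rc - F^T *m P *m B.
  by rewrite EE linearB/= !trmx_mul trmxK PT RT mulmxA.
have F'T : (F + B *m D)^T = F^T + D^T *m B^T by rewrite linearD/= trmx_mul.
have K'T : (K - D)^T = K^T - D^T by rewrite linearB.
(* Completion of the square in [D], around the gain [K]. *)
have -> : P - (F + B *m D)^T *m P *m (F + B *m D)
    - (Q + (K - D)^T *m Rc *m (K - D))
  = D^T *m E + E^T *m D - D^T *m H *m D.
  rewrite {1}PE ET EE F'T K'T /H.
  rewrite !(mulmxDl, mulmxDr, mulmxN, mulNmx) !mulmxA.
  (* Once these products are atoms, the identity is additive and [ring] checks it entrywise. *)
  move: (F^T *m P *m F) (F^T *m P *m B *m D) (D^T *m B^T *m P *m F)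
    (D^T *m B^T *m P *m B *m D) (K^T *m Rc *m K) (K^T *m Rc *m D)
    (D^T *m Rc *m K) (D^T *m Rc *m D).
  move=> FPF FPBD DBPF DBPBD KRK KRD DRK DRD.
  apply/matrixP => i j; rewrite !mxE; ring.
rewrite !mulmxBr mulmxDr raddfB raddfD/= !mulmxA.
have -> : \tr (X *m E^T *m D) = \tr (X *m D^T *m E).
  by rewrite -mxtrace_tr !trmx_mul trmxK XT mulmxA mxtrace_mulC mulmxA.
by rewrite mulr_natl mulr2n.
Qed.

(** * Plants at stabilizing gains, and sums over the grid *)

Section StabilizedPlant.
Context (R : realType) (T : Type) (S N n m : nat) (L : lpv R T S N n m).
Context (Q_posdef : posdef (Qcost L)) (R_posdef : posdef (Rcost L)).
Context (Sigma0_posdef : posdef (Sigma0 L)).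

(** [xget] returns a member of any nonempty set, so existence of a solution suffices. *)
Lemma Pmat_eq (s : 'I_S) (K : 'M[R]_(m, n)) : stabilizes L s K ->
  Pmat L s K = (Acl L s K)^T *m Pmat L s K *m Acl L s K
               + Qcost L + K^T *m Rcost L *m K.
Proof.
move=> /schur_stable_vanishes A0.
have [P PE] := stein_exists A0 (Qcost L + K^T *m Rcost L *m K).
by rewrite addrA in PE; exact: (@xgetI _ 0 [set _ | _] P PE).
Qed.

Lemma Pmat_posdef (s : 'I_S) (K : 'M[R]_(m, n)) :
  stabilizes L s K -> posdef (Pmat L s K).
Proof.
move=> sK; apply: (stein_posdef (schur_stable_vanishes sK)
  (posdef_addr_congr K Q_posdef R_posdef)).
by rewrite {1}Pmat_eq// addrA.
Qed.

Lemma Hmat_posdef (s : 'I_S) (K : 'M[R]_(m, n)) :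
  stabilizes L s K -> posdef (Hmat L s K).
Proof. by move=> sK; exact/posdef_addr_congr/Pmat_posdef. Qed.

(** The covariance equation is the Stein equation of the transposed closed loop. *)
Lemma Sigma_eq (s : 'I_S) (K : 'M[R]_(m, n)) : stabilizes L s K ->
  Sigma L s K = Acl L s K *m Sigma L s K *m (Acl L s K)^T + Sigma0 L.
Proof.
move=> /schur_stable_vanishes /vanishes_exp_trmx A0.
have [X XE] := stein_exists A0 (Sigma0 L).
by rewrite trmxK in XE; exact: (@xgetI _ 0 [set _ | _] X XE).
Qed.

Lemma Sigma_posdef (s : 'I_S) (K : 'M[R]_(m, n)) :
  stabilizes L s K -> posdef (Sigma L s K).
Proof.
move=> sK; apply: (stein_posdef (vanishes_exp_trmx (schur_stable_vanishes sK))
  Sigma0_posdef).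
by rewrite {1}Sigma_eq// trmxK.
Qed.

Lemma plant_cost_difference (s : 'I_S) (K K' : 'M[R]_(m, n)) :
  stabilizes L s K -> stabilizes L s K' ->
  plant_cost L s K - plant_cost L s K'
    = 2 * \tr (Sigma L s K' *m (K - K')^T *m Emat L s K)
      - \tr (Sigma L s K' *m (K - K')^T *m Hmat L s K *m (K - K')).
Proof.
move=> sK sK'; apply: cost_difference (Sigma_eq sK').
- exact: (Pmat_posdef sK).1.
- exact: R_posdef.1.
- exact: (Sigma_posdef sK').1.
- exact: Pmat_eq.
- exact: Pmat_eq.
Qed.

Lemma deployedB (K K' : schedule R N m n) (s : 'I_S) :
  deployed L (K - K') s = deployed L K s - deployed L K' s.
Proof. by rewrite -sumrB; apply: eq_bigr => i _; rewrite !ffunE scalerBr. Qed.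

(** Exchanging the sums over vertices and grid points lets the weights reassemble the blocks of [Z]
    into its deployed gains. *)
Lemma inner_grad_star (Kstar K Z : schedule R N m n) :
  inner (grad_star L Kstar K) Z
    = \sum_(s < S) wgt L s * (2 * \tr (Sigma_star L Kstar s *m (deployed L Z s)^T
                                         *m Emat L s (deployed L K s))).
Proof.
rewrite /inner; under eq_bigr => i _.
  rewrite ffunE [_^T]linearZ/= -scalemxAl mxtraceZ [X in X *m _]linear_sum/=.
  rewrite mulmx_suml raddf_sum/= mulr_sumr.
  over.
rewrite exchange_big/=; apply: eq_bigr => s _.
rewrite mulrCA -[in RHS]mxtrace_mulC mulmxA -mxtrace_tr trmx_mul trmxK.
rewrite /deployed mulmx_suml raddf_sum/= !mulr_sumr; apply: eq_bigr => i _.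
rewrite [X in X *m _]linearZ/= -!scalemxAl !mxtraceZ !mulrA.
by rewrite [\tr (_^T *m _)]mxtrace_mulC.
Qed.

(** Each summand is nonnegative, and positive where [Delta] is nonzero; [Gram] being positive
    definite, distinct schedules deploy distinct gains at some grid point. *)
Lemma QH_gt0 (Kstar K : schedule R N m n) :
  (forall s, 0 < wgt L s) -> posdef (Gram L) ->
  feasible L K -> feasible L Kstar -> K <> Kstar -> 0 < QH L Kstar K.
Proof.
move=> wgt_gt0 [_ Gram_gt0] fK fKs K_neq.
have Hpd s := Hmat_posdef (fK s); have Spd s := Sigma_posdef (fKs s).
have [s Ds] : exists s, Delta L Kstar K s != 0.
  apply/existsP; apply: contra_notT K_neq.
  rewrite negb_exists => /forallP D0.
  apply/ffunP => i; apply/matrixP => a b.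
  (* For a fixed entry [(a, b)], the form of [Gram] at [c] is the weighted sum of the squares of
     that entry of [Delta] over the grid, here 0. *)
  pose c := \col_i (K i - Kstar i) a b.
  suff : c = 0.
    by move=> /matrixP/(_ i 0); rewrite !mxE => /subr0_eq.
  have [//|/Gram_gt0] := eqVneq c 0.
  rewrite /Gram mulmx_sumr mulmx_suml summxE big1 ?ltxx// => s _.
  have wc0 : (\col_i w L i (grid L s))^T *m c = 0.
    apply/matrixP => x y; rewrite !ord1 !mxE.
    have := D0 s; rewrite negbK /Delta -deployedB => /eqP/matrixP/(_ a b).
    rewrite summxE !mxE => D0ab; rewrite -[RHS]D0ab; apply: eq_bigr => j _.
    by rewrite !mxE !ffunE !mxE.
  by rewrite -scalemxAr -scalemxAl -!mulmxA wc0 !mulmx0 scaler0 mxE.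
have term_ge0 t : 0 <= wgt L t *
    \tr (Sigma_star L Kstar t *m (Delta L Kstar K t)^T
      *m Hmat L t (deployed L K t) *m Delta L Kstar K t).
  have [->|Dt] := eqVneq (Delta L Kstar K t) 0.
    by rewrite mulmx0 mxtrace0 mulr0.
  by apply/ltW/mulr_gt0 => //; exact: (mxtrace_congr_gt0 (Spd t) (Hpd t) Dt).
rewrite /QH (bigD1 s)//= ltr_pwDl ?sumr_ge0// mulr_gt0//.
exact: (mxtrace_congr_gt0 (Spd s) (Hpd s) Ds).
Qed.

Lemma inner_grad_starB (Kstar K : schedule R N m n) :
  feasible L K -> feasible L Kstar ->
  inner (grad_star L Kstar K) (K - Kstar)
    = cost L K - cost L Kstar + QH L Kstar K.
Proof.
move=> fK fKs; rewrite inner_grad_star /cost /QH -sumrB -big_split/=.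
apply: eq_bigr => s _.
by rewrite -mulrBr plant_cost_difference// -mulrDr subrK deployedB.
Qed.

End StabilizedPlant.

(** * Linearity of the inner product, and the identity *)

Lemma innerZl (R : realType) (N n m : nat) (c : R) (X Z : schedule R N m n) :
  inner (c *: X) Z = c * inner X Z.
Proof.
rewrite /inner mulr_sumr; apply: eq_bigr => i _.
by rewrite ffunE [_^T]linearZ/= -scalemxAl mxtraceZ.
Qed.

Lemma innerBl (R : realType) (N n m : nat) (X Y Z : schedule R N m n) :
  inner (X - Y) Z = inner X Z - inner Y Z.
Proof.
rewrite /inner -sumrB; apply: eq_bigr => i _.
by rewrite !ffunE [_^T]linearB/= mulmxBl raddfB.
Qed.

Theorem corollary1 (R : realType) (T : topologicalType) (S N n m : nat)
    (L : lpv R T S N n m)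
    (wgt_gt0 : forall s : 'I_S, 0 < wgt L s)
    (wgt_sum1 : \sum_(s < S) wgt L s = 1)
    (w_continuous : forall i : 'I_N, continuous (w L i : T -> R))
    (w_ge0 : forall (i : 'I_N) (p : T), 0 <= w L i p)
    (w_sum1 : forall p : T, \sum_(i < N) w L i p = 1)
    (Q_posdef : posdef (Qcost L))
    (R_posdef : posdef (Rcost L))
    (Sigma0_posdef : posdef (Sigma0 L))
    (feasible_neq0 : feasible L !=set0)
    (Gram_posdef : posdef (Gram L))
    (Kstar : schedule R N m n)
    (Kstar_min : is_minimizer L Kstar)
    (K : schedule R N m n)
    (K_feasible : feasible L K)
    (K_neq : K <> Kstar) :
  inner (grad L K) (K - Kstar)
    = cost L K - cost L Kstar + (1 - mismatch L Kstar K) * QH L Kstar K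
  /\ (cost L K - cost L Kstar <= inner (grad L K) (K - Kstar)
      <-> mismatch L Kstar K <= 1).
Proof.
have [Kstar_feasible _] := Kstar_min.
have QH_pos : 0 < QH L Kstar K by exact: QH_gt0.
have identity : inner (grad L K) (K - Kstar)
    = cost L K - cost L Kstar + (1 - mismatch L Kstar K) * QH L Kstar K.
  (* As [QH] is nonzero, [mismatch * QH] is the pairing of [grad_star - grad] with [K - Kstar], and
     the starred part is known from [inner_grad_starB]. *)
  rewrite mulrBl mul1r /mismatch divfK ?gt_eqF// innerZl innerBl.
  rewrite inner_grad_starB// mulrA divff ?pnatr_eq0// mul1r.
  ring.
split=> //; rewrite identity lerDl pmulr_lge0// subr_ge0; tauto.
Qed.
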